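(* Suppose that for some input $u[0]$ the vector $$x[1]=\begin{bmatrix}x_{xx}[1]\\ x_{xy}[1]\\ x_{ux}[1]\end{bmatrix}=\begin{bmatrix}\overrightarrow{I}\\ \tilde B_0u[0]\end{bmatrix}$$ satisfies $x[1]\in\mathrm{null}(\Psi_x[1])$ for some given real matrix $\Psi_x[1]=\begin{bmatrix}\Psi_{x_1}[1]&\Psi_{x_2}[1]\end{bmatrix}$, partitioned so that $$\Psi_{x_1}[1]\,x_{xx}[1]+\Psi_{x_2}[1]\begin{bmatrix}x_{xy}[1]\\ x_{ux}[1]\end{bmatrix}=0.$$ Let $$\Gamma=\Psi_{x_2}[1]\tilde B_0,\qquad w=\operatorname*{argmin}_{M}\ \lVert \Gamma M+\Psi_{x_1}[1]\overrightarrow{I}\rVert,\qquad H_\lambda=\mathrm{basis}(\mathrm{null}(\Gamma)).$$ Then the set of admissible inputs at time $0$ is $$\mathcal A_u[0]=\{\hat u:\ \hat u=w+H_\lambda\lambda\ \text{ for some vector }\lambda\}.$$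
   Context: Fix real matrices $B\in\mathbb R^{n\times m}$, $C\in\mathbb R^{p\times n}$ (the input and output matrices of a linear system with $n$-dimensional state). For a matrix $M$, $\overrightarrow{M}$ is the column vector stacking the columns of $M$. The system-response components $\Phi_{xx}[\tau]\in\mathbb R^{n\times n}$, $\Phi_{xy}[\tau]\in\mathbb R^{n\times p}$, $\Phi_{ux}[\tau]\in\mathbb R^{m\times n}$, $\Phi_{uy}[\tau]\in\mathbb R^{m\times p}$ are vectorized as $x_{xx}[\tau]=\overrightarrow{\Phi_{xx}[\tau]}$, $x_{xy}[\tau]=\overrightarrow{\Phi_{xy}[\tau]}$, $x_{ux}[\tau]=\overrightarrow{\Phi_{ux}[\tau]}$, $u[\tau]=\overrightarrow{\Phi_{uy}[\tau]}$, and $x[\tau]$ is the vector stacking $x_{xx}[\tau],x_{xy}[\tau],x_{ux}[\tau]$. The initial condition is $\Phi_{xx}[1]=I$ (the $n\times n$ identity), $\Phi_{xy}[1]=B\Phi_{uy}[0]$, $\Phi_{ux}[1]=\Phi_{uy}[0]C$, whose vectorized form is $x[1]=\begin{bmatrix}\overrightarrow{I}\\ \tilde B_0u[0]\end{bmatrix}$; explicitly, with $\otimes$ the Kronecker product, $\tilde B_0=\begin{bmatrix}I_p\otimes B\\ C^\top\otimes I_m\end{bmatrix}$. The set of admissible inputs at time $0$ (given $\Psi_x[1]$; no further system-level constraints are imposed) is $$\mathcal A_u[0]=\left\{\hat u:\ \begin{bmatrix}\overrightarrow{I}\\ \tilde B_0\hat u\end{bmatrix}\in\mathrm{null}(\Psi_x[1])\right\}.$$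 Notation: $\mathrm{null}(\Psi)=\{v:\Psi v=0\}$; $\mathrm{basis}(\mathcal S)$ denotes a matrix whose columns form a basis of the linear subspace $\mathcal S$ (it has no columns if $\mathcal S=\{0\}$). $\lVert\cdot\rVert$ is the Euclidean norm, and $w=\operatorname{argmin}_M(\cdot)$ means that $w$ is a minimizer over all real column vectors $M$ of compatible size. *)

(* Defs.v *)
From HB Require Import structures.
From mathcomp Require Import all_boot all_order all_algebra.
From mathcomp Require Import classical_sets reals.
From mathcomp Require Import mxtens.

Set Implicit Arguments.
Unset Strict Implicit.
Unset Printing Implicit Defensive.

Import Order.TTheory GRing.Theory Num.Theory.
Local Open Scope ring_scope.
Local Open Scope classical_set_scope.

(* [mxvec] lists the entries of a matrix row by row, as a row vector; hence
   the two transpositions to stack the columns. *)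
Definition colvec (R : Type) (a b : nat) (M : 'M[R]_(a, b)) : 'cV[R]_(b * a) :=
  (mxvec M^T)^T.

Definition nullspace (F : fieldType) (a b : nat) (A : 'M[F]_(a, b)) :
    {vspace 'cV[F]_b} :=
  lker (linfun (mulmx A)).

Definition basis_mx (F : fieldType) (N k : nat) (S : {vspace 'cV[F]_N})
    (H : 'M[F]_(N, k)) : bool :=
  basis_of S [seq col j H | j <- enum 'I_k].

(* The norm of MathComp-Analysis on matrices is the sup norm. *)
Definition enorm (R : rcfType) (N : nat) (v : 'cV[R]_N) : R :=
  Num.sqrt (\sum_i v i 0 ^+ 2).

Definition is_argmin (R : realType) (T : Type) (f : T -> R) (w : T) : Prop :=
  forall M : T, f w <= f M.

Section SystemResponse.
Variables (R : realType) (n m p : nat).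
Variables (B : 'M[R]_(n, m)) (C : 'M[R]_(p, n)).

(* [A *t B] is the Kronecker product, with blocks [A i j *: B]. *)
Definition tildeB0 : 'M[R]_(p * n + n * m, p * m) :=
  col_mx (1%:M *t B) (C^T *t 1%:M).

(* The stacked vector x[1], as a function of u[0]. *)
Definition initial_state (u : 'cV[R]_(p * m)) :
    'cV[R]_(n * n + (p * n + n * m)) :=
  col_mx (colvec (1%:M : 'M[R]_n)) (tildeB0 *m u).

Definition admissible_inputs (q : nat)
    (Psi : 'M[R]_(q, n * n + (p * n + n * m))) : set 'cV[R]_(p * m) :=
  [set u | initial_state u \in nullspace Psi].

End SystemResponse.

Lemma nth_allpairs_pair (S T : Type) x0 y0 (s : seq S) (t : seq T) i j :
  (i < size s)%N -> (j < size t)%N ->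
  nth (x0, y0) [seq (x, y) | x <- s, y <- t] (i * size t + j) =
    (nth x0 s i, nth y0 t j).
Proof.
elim: s i => [//|x s IHs] [|i] Hi Hj; rewrite /= nth_cat size_map.
  by rewrite mul0n add0n Hj (nth_map y0).
by rewrite mulSn -addnA ltnNge leq_addr /= addKn IHs.
Qed.

Lemma mxvec_index_tens (a b : nat) (i : 'I_a) (j : 'I_b) :
  mxvec_index i j = mxtens_index (i, j).
Proof.
apply: val_inj => /=.
suff E : (i * b + j = index (i, j) (enum {: 'I_a * 'I_b}))%N.
  rewrite E -[in RHS](nth_enum_rank (i, j) (i, j)) index_uniq ?enum_uniq //.
  by rewrite -(cardE {: 'I_a * 'I_b}) ltn_ord.
have Hn : nth (i, j) (enum {: 'I_a * 'I_b}) (i * b + j) = (i, j).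
  rewrite enumT unlock /= /prod_enum -[X in (i * X)%N](size_enum_ord b).
  by rewrite (nth_allpairs_pair i j) ?size_enum_ord // !nth_ord_enum.
rewrite -[in RHS]Hn index_uniq ?enum_uniq // -cardE card_prod !card_ord.
exact: (mxtens_index_proof (i, j)).
Qed.

Lemma colvecE (R : Type) (a b : nat) (M : 'M[R]_(a, b)) i j z :
  colvec M (mxtens_index (i, j)) z = M j i.
Proof. by rewrite ord1 mxE -mxvec_index_tens mxvecE mxE. Qed.

Lemma colvec_mulmx (R : comPzRingType) (a b c d : nat)
    (A : 'M[R]_(a, b)) (X : 'M[R]_(b, c)) (D : 'M[R]_(c, d)) :
  colvec (A *m X *m D) = (D^T *t A) *m colvec X.
Proof.
apply/colP => k; case: (mxtens_indexP k) => i j.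
rewrite colvecE !mxE.
rewrite (reindex (@mxtens_index c b)) /=; last first.
  by exists (@mxtens_unindex c b) => x _; rewrite (mxtens_indexK, mxtens_unindexK).
rewrite [RHS](eq_bigr (fun x => D x.1 i * A j x.2 * X x.2 x.1)); last first.
  by move=> [x y] _; rewrite tensmxE colvecE mxE.
rewrite -(pair_bigA _ (fun x y => D x i * A j y * X y x)) /=.
apply: eq_bigr => x _; rewrite mxE mulr_suml; apply: eq_bigr => y _.
by rewrite mulrC mulrA.
Qed.

(* [tildeB0] vectorizes Phi_xy[1] = B Phi_uy[0] and Phi_ux[1] = Phi_uy[0] C. *)
Lemma initial_stateE (R : realType) (n m p : nat) (B : 'M[R]_(n, m))
    (C : 'M[R]_(p, n)) (Phi_uy : 'M[R]_(m, p)) :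
  initial_state B C (colvec Phi_uy) =
    col_mx (colvec (1%:M : 'M[R]_n))
      (col_mx (colvec (B *m Phi_uy)) (colvec (Phi_uy *m C))).
Proof.
rewrite /initial_state mul_col_mx.
by rewrite -[B *m _]mulmx1 -[Phi_uy *m C]mul1mx mulmxA !colvec_mulmx trmx1.
Qed.

(* Main.v *)
Require Import Defs.
From mathcomp Require Import all_boot all_order all_algebra.
From mathcomp Require Import classical_sets reals.

(** An input [u] is admissible exactly when it solves the affine equation
    [Gamma u + Psi1 vec(I) = 0], since the block row [(Psi1 Psi2)] applied to
    the initial state [(vec(I); tildeB0 u)] is the left-hand side
    ([admissible_inputsE]).  The input [u0] shows that this equation is
    solvable, so the least residual norm is zero and the least-squares
    minimizer [w] is itself a solution ([argmin_enorm_eq0]).  Two solutions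
    differ by an element of the null space of [Gamma], and the elements of
    that null space are the vectors [H lambda] ([basis_mxP]). *)

Import Order.TTheory GRing.Theory Num.Theory.
Local Open Scope ring_scope.
Local Open Scope classical_set_scope.

Lemma mem_nullspace (F : fieldType) (a b : nat) (A : 'M[F]_(a, b))
    (v : 'cV[F]_b) :
  (v \in nullspace A) = (A *m v == 0).
Proof. by rewrite memv_ker lfunE. Qed.

Lemma mulmx_sum_col (F : fieldType) (N k : nat) (H : 'M[F]_(N, k))
    (v : 'cV[F]_k) :
  H *m v = \sum_j v j 0 *: col j H.
Proof.
apply/colP => i; rewrite mxE summxE; apply: eq_bigr => j _.
by rewrite !mxE mulrC.
Qed.

Lemma basis_mxP (F : fieldType) (N k : nat) (S : {vspace 'cV[F]_N})
    (H : 'M[F]_(N, k)) (v : 'cV[F]_N) :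
  basis_mx S H -> (v \in S) <-> exists lambda : 'cV[F]_k, v = H *m lambda.
Proof.
move=> /span_basis <-; split => [v_in | [lambda ->]].
  pose X := map_tuple (fun j => col j H) (ord_tuple k).
  exists (\col_j coord X j v).
  rewrite mulmx_sum_col {1}(coord_span (X := X) v_in).
  apply: eq_bigr => j _.
  by rewrite mxE -tnth_nth tnth_map tnth_ord_tuple.
rewrite mulmx_sum_col; apply: memv_suml => j _.
by apply/memvZ/memv_span/map_f; rewrite mem_enum.
Qed.
Arguments basis_mxP {F N k S H v}.

Lemma enorm_ge0 (R : rcfType) (N : nat) (v : 'cV[R]_N) : 0 <= enorm v.
Proof. exact: sqrtr_ge0. Qed.

Lemma enorm_eq0 (R : rcfType) (N : nat) (v : 'cV[R]_N) :
  (enorm v == 0) = (v == 0).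
Proof.
have sq_ge0 (i : 'I_N) : true -> 0 <= v i 0 ^+ 2 by move=> _; apply: sqr_ge0.
rewrite sqrtr_eq0 le_eqVlt ltNge sumr_ge0 // orbF psumr_eq0 //.
apply/allP/eqP => [v0 | -> i _]; last by rewrite /= mxE expr0n eqxx.
apply/colP => i; rewrite [RHS]mxE; apply/eqP.
by rewrite -sqrf_eq0; apply: v0; rewrite mem_index_enum.
Qed.

(** The norm is nonnegative, so a zero of [f] already attains the minimum, and
    only the zero vector has norm zero. *)
Lemma argmin_enorm_eq0 (R : realType) (T : Type) (N : nat)
    (f : T -> 'cV[R]_N) (w z : T) :
  is_argmin (fun x => enorm (f x)) w -> f z = 0 -> f w = 0.
Proof.
move=> w_min fz0; apply/eqP; rewrite -enorm_eq0 eq_le enorm_ge0 andbT.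
have /eqP <- : enorm (f z) == 0 by rewrite enorm_eq0 fz0.
exact: w_min.
Qed.
Arguments argmin_enorm_eq0 {R T N f w z}.

Lemma admissible_inputsE (R : realType) (n m p q : nat)
    (B : 'M[R]_(n, m)) (C : 'M[R]_(p, n))
    (Psi1 : 'M[R]_(q, n * n)) (Psi2 : 'M[R]_(q, p * n + n * m))
    (u : 'cV[R]_(p * m)) :
  (initial_state B C u \in nullspace (row_mx Psi1 Psi2)) =
    (Psi2 *m tildeB0 B C *m u + Psi1 *m colvec (1%:M : 'M[R]_n) == 0).
Proof. by rewrite mem_nullspace mul_row_col mulmxA addrC. Qed.

Theorem theorem3 (R : realType) (n m p q k : nat)
    (B : 'M[R]_(n, m)) (C : 'M[R]_(p, n))
    (Psi1 : 'M[R]_(q, n * n)) (Psi2 : 'M[R]_(q, p * n + n * m))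
    (u0 w : 'cV[R]_(p * m)) (H : 'M[R]_(p * m, k)) :
  let Psi := row_mx Psi1 Psi2 in
  let Gamma := Psi2 *m tildeB0 B C in
  initial_state B C u0 \in nullspace Psi ->
  is_argmin (fun M : 'cV[R]_(p * m) =>
    enorm (Gamma *m M + Psi1 *m colvec (1%:M : 'M[R]_n))) w ->
  basis_mx (nullspace Gamma) H ->
  admissible_inputs B C Psi =
    [set uhat | exists lambda : 'cV[R]_k, uhat = w + H *m lambda].
Proof.
move=> Psi Gamma; rewrite admissible_inputsE -/Gamma => /eqP u0_sol w_min H_basis.
have w_sol := argmin_enorm_eq0 w_min u0_sol.
have admissibleP u : initial_state B C u \in nullspace Psi <->
    u - w \in nullspace Gamma.
  rewrite admissible_inputsE -/Gamma mem_nullspace mulmxBr.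
  by rewrite -[_ *m u + _]subr0 -{1}w_sol opprD addrACA subrr addr0.
apply/seteqP; split=> u; rewrite /admissible_inputs /=.
  move=> /admissibleP/(basis_mxP H_basis)[lambda u_w].
  by exists lambda; rewrite -u_w addrC subrK.
move=> [lambda ->]; apply/admissibleP/(basis_mxP H_basis).
by exists lambda; rewrite addrC addKr.
Qed.
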